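(* Let $\rho > 0$ and $A \in L(H)$. Then the following are equivalent: (i) $\tau - A$ has an inverse $(\tau - A)^{-1} \in L(\ell_{2,\rho}(\mathbb{Z}; H))$ and this inverse is causal; (ii) $(\tau - A)^{-1} \in L(\ell_{2,\rho}(\mathbb{Z}; H))$ and $\operatorname{spt} (\tau - A)^{-1} \delta_{-1} x \subseteq \mathbb{Z}_{\geq 0}$ for all $x \in H$; (iii) $\rho > r(A)$.
   Context: $H$ is a separable complex Hilbert space, $L(X)$ denotes bounded linear operators on $X$. $\ell_{2,\rho}(\mathbb{Z}; H) = \{x \in H^{\mathbb{Z}} : \sum_{k} |x_k|_H^2 \rho^{-2k} < \infty\}$ with norm $(\sum_k|x_k|_H^2\rho^{-2k})^{1/2}$. $\tau$ is the shift $(\tau x)_k = x_{k+1}$, and $A$ also denotes the operator $x\mapsto (Ax_k)_{k\in\mathbb{Z}}$ on $\ell_{2,\rho}(\mathbb{Z};H)$. $\operatorname{spt} x = \{k : x_k \neq 0\}$; $\delta_{-1}x\in H^{\mathbb{Z}}$ is the sequence with entry $x$ at index $-1$ and $0$ elsewhere. $r(A) = \sup\{|z| : z\in\sigma(A)\}$ is the spectral radius. A linear operator $B$ on $\ell_{2,\rho}(\mathbb{Z};H)$ is causal if for all $a\in\mathbb{Z}$ and $f\in\ell_{2,\rho}(\mathbb{Z};H)$, $\operatorname{spt} f\subseteq\mathbb{Z}_{\geq a}$ implies $\operatorname{spt} Bf\subseteq\mathbb{Z}_{\geq a}$. *)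

(* Defs.v *)
From HB Require Import structures.
From mathcomp Require Import all_boot all_order all_algebra.
From mathcomp Require Import complex.
From mathcomp Require Import boolp classical_sets reals ereal esum.
Set Implicit Arguments. Unset Strict Implicit. Unset Printing Implicit Defensive.
Import Order.TTheory GRing.Theory Num.Theory.
Local Open Scope ring_scope.
Local Open Scope classical_set_scope.

Definition cmod (R : rcfType) (z : R[i]) : R := ComplexField.Normc.normc z.

Section Hilbert.
Variables (R : realType) (H : lmodType R[i]) (ip : H -> H -> R[i]).

Definition hnorm (x : H) : R := Num.sqrt (complex.Re (ip x x)).

Definition is_separable_Hilbert : Prop :=
  [/\ (forall (a : R[i]) (x y z : H), ip (a *: x + y) z = a * ip x z + ip y z),
      (forall x y : H, ip y x = conjc (ip x y)),
      (forall x : H, 0 <= ip x x),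
      (forall x : H, ip x x = 0 -> x = 0) /\
      (forall u : nat -> H,
         (forall e : R, 0 < e -> exists N, forall m n, (N <= m)%N -> (N <= n)%N ->
             hnorm (u m - u n) < e) ->
         exists l : H, forall e : R, 0 < e -> exists N, forall n, (N <= n)%N ->
             hnorm (u n - l) < e)
    &
      exists d : nat -> H, forall (x : H) (e : R), 0 < e -> exists n, hnorm (x - d n) < e].

Definition bounded_op (T : H -> H) : Prop :=
  (forall (a : R[i]) (x y : H), T (a *: x + y) = a *: T x + T y) /\
  exists M : R, forall x, hnorm (T x) <= M * hnorm x.

Definition invertible_op (T : H -> H) : Prop :=
  exists S : H -> H, [/\ bounded_op S, (forall x, S (T x) = x) & (forall x, T (S x) = x)].

Definition spectrum (A : H -> H) : set R[i] :=
  [set z | ~ invertible_op (fun x => z *: x - A x)].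

Definition spectral_radius (A : H -> H) : \bar R :=
  ereal_sup [set (cmod z)%:E | z in spectrum A].

Definition l2w_sum (rho : R) (f : int -> H) : \bar R :=
  \esum_(k in [set: int]) ((hnorm (f k)) ^+ 2 * rho ^ (- (2 * k)))%:E.

Definition in_l2 (rho : R) (f : int -> H) : Prop := (l2w_sum rho f < +oo)%E.

Definition l2norm (rho : R) (f : int -> H) : R := Num.sqrt (fine (l2w_sum rho f)).

Definition bounded_l2_op (rho : R) (B : (int -> H) -> (int -> H)) : Prop :=
  [/\ (forall f, in_l2 rho f -> in_l2 rho (B f)),
      (forall (a : R[i]) f g, in_l2 rho f -> in_l2 rho g ->
          B (fun k => a *: f k + g k) = (fun k => a *: B f k + B g k))
    & exists M : R, forall f, in_l2 rho f -> l2norm rho (B f) <= M * l2norm rho f].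

Definition tau_minus (A : H -> H) (f : int -> H) : int -> H :=
  fun k => f (k + 1) - A (f k).

Definition is_l2_inverse (rho : R) (A : H -> H) (B : (int -> H) -> (int -> H)) : Prop :=
  [/\ bounded_l2_op rho B,
      (forall f, in_l2 rho f -> B (tau_minus A f) = f)
    & (forall f, in_l2 rho f -> tau_minus A (B f) = f)].

Definition spt (f : int -> H) : set int := [set k | f k != 0].

Definition causal (rho : R) (B : (int -> H) -> (int -> H)) : Prop :=
  forall (a : int) (f : int -> H), in_l2 rho f ->
    spt f `<=` [set k | a <= k] -> spt (B f) `<=` [set k | a <= k].

Definition delta_m1 (x : H) : int -> H := fun k => if k == -1 then x else 0.

End Hilbert.

(* Main.v *)
(**
  (ii) => (iii): the solution of (tau - A) y = delta_(-1) x supported in k >= 0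
  is y_k = A^k x, so boundedness of the inverse makes the orbits of A / rho
  square summable, uniformly in x; Datko's argument then gives
  |A^n x| <= rho^n |x| / 2 for some n > 0, and hence (with an equivalent norm in
  which A / s is contractive for some s < rho) r(A) < rho.

  (iii) => (i): the spectral radius formula is proved without complex analysis.
  By compactness (1 - w A)^-1 is uniformly bounded on the disc |w| <= 1 / rho,
  so w -> (1 - w A)^-1 varies little under w -> c w for c < 1 close to 1.
  The identity (1 - X^2)^-1 = ((1 - X)^-1 + (1 + X)^-1) / 2 transports this
  estimate, with the same constant, to (1 - w^n A^n)^-1 for n = 2^k.  Hence
  smallness of A^n / t^n for some n = 2^k passes from t to c t as long as
  c t >= rho, and it holds for t large.  In the equivalent norm above the causal
  solution y_k = sum_j A^j f_(k-1-j) then converges and is bounded in l_2.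
*)

Require Import Defs.
From HB Require Import structures.
From mathcomp Require Import all_boot all_order all_algebra.
From mathcomp Require Import complex.
From mathcomp Require Import boolp classical_sets reals ereal esum.
From mathcomp Require Import cardinality fsbigop topology normedtype sequences.
From mathcomp Require Import zify ring lra.
Set Implicit Arguments.
Unset Strict Implicit.
Unset Printing Implicit Defensive.
Import Order.TTheory GRing.Theory Num.Theory numFieldNormedType.Exports.
Local Open Scope ring_scope.
Local Open Scope classical_set_scope.

(** * Small powers of reals and the complex modulus *)

Section Scalars.
Variable R : realType.
Implicit Types (z w : R[i]) (c : R).

Lemma expr_small c (e : R) : 0 <= c -> c < 1 -> 0 < e ->
  exists n, c ^+ n < e.
Proof.
move=> c0 c1 e0.
have /cvgrPdist_lt/(_ e e0) [n _ /(_ n (leqnn n))] : (fun n => c ^+ n) @ \oo --> (0 : R).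
  by apply: cvg_expr; rewrite ger0_norm.
by rewrite /= sub0r normrN ger0_norm ?exprn_ge0// => ?; exists n.
Qed.

Lemma archi_ge (x : R) : exists m : nat, x <= m%:R.
Proof. by exists (Num.truncn x).+1; apply/ltW/truncnS_gt. Qed.

Lemma cmod_ge0 z : 0 <= cmod z.
Proof. by case: z => a b; rewrite sqrtr_ge0. Qed.

Lemma cmodM z w : cmod (z * w) = cmod z * cmod w.
Proof. exact: ComplexField.Normc.normcM. Qed.

Lemma cmodV z : cmod z^-1 = (cmod z)^-1.
Proof. exact: ComplexField.Normc.normcV. Qed.

Lemma cmodX z n : cmod (z ^+ n) = cmod z ^+ n.
Proof.
elim: n => [|n IH]; first by rewrite !expr0 /cmod ComplexField.Normc.normc1.
by rewrite !exprS cmodM IH.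
Qed.

Lemma cmod_real c : cmod (c%:C)%C = `|c|.
Proof. by rewrite /cmod /= expr0n /= addr0 sqrtr_sqr. Qed.

Lemma cmod_gt0 z : z != 0 -> 0 < cmod z.
Proof.
move=> z0; rewrite lt_def cmod_ge0 andbT; apply: contraNneq z0.
by move=> /(@ComplexField.Normc.eq0_normc _ _) ->.
Qed.

End Scalars.

(** * The Hilbert space norm: Cauchy-Schwarz and geometric convergence *)

Section HilbertNorm.
Variables (R : realType) (H : lmodType R[i]) (ip : H -> H -> R[i]).
Hypothesis hH : is_separable_Hilbert ip.
Local Notation N := (hnorm ip).

Let ip_lin (a : R[i]) (x y z : H) : ip (a *: x + y) z = a * ip x z + ip y z.
Proof. by case: hH. Qed.

Let ip_conj (x y : H) : ip y x = conjc (ip x y).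
Proof. by case: hH. Qed.

Let ipDl x y z : ip (x + y) z = ip x z + ip y z.
Proof. by rewrite -[x]scale1r ip_lin mul1r scale1r. Qed.

Let ip0l z : ip 0 z = 0.
Proof. by apply: (addrI (ip 0 z)); rewrite -ipDl !addr0. Qed.

Let ipZl a x z : ip (a *: x) z = a * ip x z.
Proof. by rewrite -[a *: x]addr0 ip_lin ip0l addr0. Qed.

Let ipDr x y z : ip z (x + y) = ip z x + ip z y.
Proof. by rewrite ip_conj ipDl rmorphD /= -!ip_conj. Qed.

Let ipZr a x z : ip z (a *: x) = conjc a * ip z x.
Proof. by rewrite ip_conj ipZl rmorphM /= -ip_conj. Qed.

Let ip_ge0 x : 0 <= ip x x.
Proof. by case: hH. Qed.

Let Re_ip_ge0 x : 0 <= complex.Re (ip x x).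
Proof. by have := ip_ge0 x; rewrite lecE => /andP[]. Qed.

Let ip_diag x : ip x x = ((complex.Re (ip x x))%:C)%C.
Proof. by have /ger0_Im := ip_ge0 x; case: (ip x x) => a b /= ->. Qed.

Lemma hnorm_ge0 x : 0 <= N x.
Proof. exact: sqrtr_ge0. Qed.

Lemma sqr_hnorm x : N x ^+ 2 = complex.Re (ip x x).
Proof. exact: sqr_sqrtr. Qed.

Lemma hnorm_scale a x : N (a *: x) = cmod a * N x.
Proof.
rewrite /hnorm ipZl ipZr [ip x x]ip_diag /cmod.
case: a => a b /=; rewrite -sqrtrM ?addr_ge0 ?sqr_ge0 //; congr Num.sqrt; ring.
Qed.

Lemma hnorm_opp x : N (- x) = N x.
Proof.
rewrite -scaleN1r hnorm_scale /cmod /= oppr0 expr0n /= addr0 sqrrN expr1n.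
by rewrite sqrtr1 mul1r.
Qed.

Lemma hnorm0 : N 0 = 0.
Proof. by rewrite /hnorm ip0l sqrtr0. Qed.

Lemma hnorm_eq0 x : N x = 0 -> x = 0.
Proof.
move=> Nx; case: hH => _ _ _ [h _] _; apply: h.
by rewrite ip_diag -sqr_hnorm Nx expr0n.
Qed.

Lemma hnorm_triangle x y : N (x + y) <= N x + N y.
Proof.
have sq (t : R) : N (x + (t%:C)%C *: y) ^+ 2 =
    N x ^+ 2 + 2 * t * complex.Re (ip x y) + t ^+ 2 * N y ^+ 2.
  rewrite !sqr_hnorm ipDl !ipDr !ipZl !ipZr [ip y x]ip_conj.
  rewrite [ip y y]ip_diag; case: (ip x y) (ip x x) => a b [c d] /=; ring.
have CS : complex.Re (ip x y) <= N x * N y.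
  have [y0|y0] := eqVneq (N y) 0.
    by rewrite (hnorm_eq0 y0) ip_conj ip0l hnorm0 mulr0 /=.
  have Ny : 0 < N y by rewrite lt_def y0 hnorm_ge0.
  rewrite leNgt; apply/negP => gt.
  have /ltW h : 0 < complex.Re (ip x y) by apply: le_lt_trans gt; rewrite mulr_ge0 ?hnorm_ge0.
  (* At t = - |x| / |y| the square in [sq] equals 2 (|x| / |y|) (|x| |y| - Re <x, y>), which is
     negative if Cauchy-Schwarz fails. *)
  have := sqr_ge0 (N (x + ((- (N x / N y))%:C)%C *: y)); rewrite sq.
  have [x0|x0] := eqVneq (N x) 0.
    by move: gt; rewrite (hnorm_eq0 x0) ip0l hnorm0 mul0r ltxx.
  have Nx : 0 < N x by rewrite lt_def x0 hnorm_ge0.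
  rewrite leNgt => /negP; apply.
  have -> : N x ^+ 2 + 2 * - (N x / N y) * complex.Re (ip x y) +
     (- (N x / N y)) ^+ 2 * N y ^+ 2 =
     2 * (N x / N y) * (N x * N y - complex.Re (ip x y)) by field.
  by rewrite pmulr_rlt0 ?subr_lt0// mulr_gt0 ?divr_gt0.
rewrite -(@ler_pXn2r _ 2) ?nnegrE ?addr_ge0 ?hnorm_ge0//.
have := sq 1; rewrite scale1r => ->; rewrite expr1n.
have -> : (N x + N y) ^+ 2 = N x ^+ 2 + 2 * (N x * N y) + N y ^+ 2 by ring.
lra.
Qed.

Lemma hnorm_sub_le x y : N (x - y) <= N x + N y.
Proof. by rewrite -(hnorm_opp y) hnorm_triangle. Qed.

Lemma hnorm_distC x y : N (x - y) = N (y - x).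
Proof. by rewrite -hnorm_opp opprB. Qed.

Lemma hnorm_small_eq x y : (forall e, 0 < e -> N (x - y) <= e) -> x = y.
Proof.
move=> h; apply/eqP; rewrite -subr_eq0; apply/eqP/hnorm_eq0/eqP.
rewrite eq_le hnorm_ge0 andbT; apply/ler_addgt0Pr => e e0.
by rewrite add0r h.
Qed.

(** The explicit rate is used beyond convergence: at n = 0 it bounds the limit, and for large n it
    controls the residual of the equation that the limit should solve. *)
Lemma geometric_cvg (u : nat -> H) (C c : R) : 0 <= C -> 0 <= c -> c < 1 ->
  (forall n, N (u n.+1 - u n) <= C * c ^+ n) ->
  exists l, forall n, N (u n - l) <= C / (1 - c) * c ^+ n.
Proof.
move=> C0 c0 c1 hu.
have d0 : 0 < 1 - c by rewrite subr_gt0.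
have D0 : 0 <= C / (1 - c) by rewrite divr_ge0// ltW.
have hb n k : N (u (n + k)%N - u n) <= C / (1 - c) * c ^+ n.
  suff : N (u (n + k)%N - u n) <= C / (1 - c) * (c ^+ n - c ^+ (n + k)).
    move=> /le_trans; apply; rewrite ler_wpM2l// lerBlDr lerDl exprn_ge0//.
  elim: k => [|k IH]; first by rewrite addn0 !subrr hnorm0 mulr0.
  rewrite addnS -(subrKA (u (n + k)%N)) (le_trans (hnorm_triangle _ _))//.
  apply: (le_trans (lerD (hu _) IH)); rewrite exprS le_eqVlt; apply/orP; left.
  by apply/eqP; field; rewrite gt_eqF.
have cau e : 0 < e -> exists M, forall m n, (M <= m)%N -> (M <= n)%N -> N (u m - u n) < e.
  move=> e0.
  have [M hM] := expr_small c0 c1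
     (divr_gt0 e0 (mulr_gt0 (ltr0n _ 2) (ltr_wpDl D0 ltr01))).
  exists M => m n /subnKC <- /subnKC <-.
  rewrite -(subrKA (u M)) (le_lt_trans (hnorm_triangle _ _))// [N (u M - _)]hnorm_distC.
  apply: (le_lt_trans (lerD (hb _ _) (hb _ _))).
  move: hM; rewrite ltr_pdivlMr; last by rewrite mulr_gt0// ltr_wpDl.
  have := exprn_ge0 M c0; nra.
case: hH => _ _ _ [_ /(_ u cau) [l hl]] _; exists l => n.
apply/ler_addgt0Pr => e e0; have [M hM] := hl e e0.
rewrite -(subrKA (u (n + M)%N)) (le_trans (hnorm_triangle _ _))// lerD//.
  by rewrite hnorm_distC hb.
by rewrite ltW// hM// leq_addl.
Qed.

Lemma bounded_op_bound (A : H -> H) : bounded_op ip A ->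
  exists M, 0 < M /\ forall x, N (A x) <= M * N x.
Proof.
move=> [_ [M hM]]; exists (`|M| + 1); split; first by rewrite ltr_wpDl.
move=> x; apply: (le_trans (hM x)); rewrite ler_wpM2r ?hnorm_ge0//.
by rewrite (le_trans (ler_norm M))// lerDl.
Qed.

End HilbertNorm.

(** * Linear maps given as plain functions *)

Section LinearMaps.
Variables (K : pzRingType) (V : lmodType K) (T : V -> V).
Hypothesis linT : linear T.

Lemma linearB_map x y : T (x - y) = T x - T y.
Proof. by rewrite -scaleN1r addrC linT scaleN1r addrC. Qed.

Lemma linear0_map : T 0 = 0.
Proof. by rewrite -{1}(subrr 0) linearB_map subrr. Qed.

Lemma linearD_map x y : T (x + y) = T x + T y.
Proof. by rewrite -[x]scale1r linT !scale1r. Qed.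

Lemma linearZ_map a x : T (a *: x) = a *: T x.
Proof. by rewrite -[a *: x]addr0 linT linear0_map addr0. Qed.

Lemma linear_iter n : linear (iter n T).
Proof. by elim: n => [|n IH] a x y //=; rewrite IH linT. Qed.

End LinearMaps.

(** * Equivalent norms adapted to A, and the Neumann series *)

Section AdaptedNorm.
Variables (R : realType) (H : lmodType R[i]) (ip : H -> H -> R[i]).
Hypothesis hH : is_separable_Hilbert ip.
Local Notation N := (hnorm ip).

(** L is a norm equivalent to [hnorm] in which A has operator norm at most s. Information on the
    powers of A reaches the resolvent series and the l_2 estimates only through these fields. *)
Record adapted_norm (A : H -> H) (s C : R) (L : H -> R) : Prop := AdaptedNorm {
  adapted_const_ge0 : 0 <= C;
  adapted_ge : forall x, N x <= L x;
  adapted_le : forall x, L x <= C * N x;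
  adaptedD : forall x y, L (x + y) <= L x + L y;
  adaptedZ : forall a x, L (a *: x) = cmod a * L x;
  adapted_contract : forall x, L (A x) <= s * L x }.

Lemma hnorm_iter (A : H -> H) (M : R) : 0 <= M -> (forall x, N (A x) <= M * N x) ->
  forall n x, N (iter n A x) <= M ^+ n * N x.
Proof.
move=> M0 hM; elim=> [|n IH] x; first by rewrite /= expr0 mul1r.
by rewrite iterS exprS -mulrA; apply: (le_trans (hM _)); rewrite ler_wpM2l.
Qed.

Lemma bernoulli_sub (e : R) n : 0 <= e <= 1 -> 1 - n%:R * e <= (1 - e) ^+ n.
Proof.
move=> /andP[e0 e1]; elim: n => [|n IH]; first by rewrite mul0r subr0.
rewrite exprS; apply: (@le_trans _ _ ((1 - e) * (1 - n%:R * e))); last first.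
  by rewrite ler_wpM2l// subr_ge0.
have := ler0n R n; rewrite -natr1; nra.
Qed.

(** With n the old [n.+1], let L x be the sum of s^-i |A^i x| over i < n. Applying A shifts the sum,
    so L (A x) = s (L x - |x| + s^-n |A^n x|), which is at most s L x once |A^n x| <= s^n |x|. The
    factor 1/2 leaves room for s < t. *)
Lemma exists_adapted_norm (A : H -> H) (t : R) n : 0 < t -> bounded_op ip A ->
  (forall x, N (iter n.+1 A x) <= 2^-1 * t ^+ n.+1 * N x) ->
  exists (s C : R) (L : H -> R), [/\ 0 < s, s < t & adapted_norm A s C L].
Proof.
move: n.+1 (ltn0Sn n) => {}n n0 t0 hA hn; have [M [M0 hM]] := bounded_op_bound hA.
have nR : 1 <= n%:R :> R by rewrite ler1n.
(* By Bernoulli (1 - e)^n >= 1 - n e = 3/4, more than the 1/2 required. *)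
pose e : R := (4 * n%:R)^-1.
have n4 : 0 < 4 * n%:R :> R by rewrite mulr_gt0// (lt_le_trans ltr01).
have e0 : 0 < e by rewrite invr_gt0.
have ne : n%:R * e = 4^-1 by rewrite /e; field; rewrite gt_eqF// (lt_le_trans ltr01).
have e1 : e <= 4^-1 by rewrite -ne ler_peMl// ltW.
pose s := t * (1 - e).
have s0 : 0 < s by rewrite mulr_gt0//; lra.
have hs x : N (iter n A x) <= s ^+ n * N x.
  apply: (le_trans (hn x)); rewrite ler_wpM2r ?hnorm_ge0// /s exprMn mulrC.
  rewrite ler_wpM2l ?exprn_ge0 ?ltW//.
  by have := @bernoulli_sub e n; rewrite ne => /(_ ltac:(lra)); lra.
pose L x := \sum_(i < n) s ^- i * N (iter i A x).
have si i : 0 <= s ^- i by rewrite invr_ge0 exprn_ge0// ltW.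
have linA i := linear_iter (proj1 hA) i.
exists s, (\sum_(i < n) s ^- i * M ^+ i), L; split=> //.
  by rewrite /s gtr_pMr//; lra.
split.
- by apply: sumr_ge0 => i _; rewrite mulr_ge0// exprn_ge0// ltW.
- move=> x; rewrite /L -(prednK n0) big_ord_recl /= invr1 mul1r lerDl.
  by apply: sumr_ge0 => i _; rewrite mulr_ge0// hnorm_ge0.
- move=> x; rewrite /L mulr_suml; apply: ler_sum => i _.
  by rewrite -mulrA ler_wpM2l// (hnorm_iter (ltW M0) hM).
- move=> x y; rewrite /L -big_split; apply: ler_sum => i _ /=.
  by rewrite -mulrDr ler_wpM2l// (linearD_map (linA i)) (hnorm_triangle hH).
- move=> a x; rewrite /L mulr_sumr; apply: eq_bigr => i _.
  by rewrite (linearZ_map (linA i)) (hnorm_scale hH) mulrCA.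
move=> x; pose F i := s ^- i * N (iter i A x).
have -> : L (A x) = s * \sum_(i < n) F i.+1.
  rewrite /L mulr_sumr; apply: eq_bigr => i _; rewrite /F -iterSr exprS.
  by field; rewrite !gt_eqF// exprn_gt0.
rewrite ler_pM2l//; have : \sum_(i < n.+1) F i = \sum_(i < n) F i + F n.
  by rewrite big_ord_recr.
rewrite big_ord_recl {1}/F invr1 mul1r /= => h.
rewrite -(lerD2l (N x)) h addrC lerD2r /F mulrC ler_pdivrMr ?exprn_gt0//.
by rewrite mulrC hs.
Qed.

Section Iterates.
Variables (A : H -> H) (s C : R) (L : H -> R).
Hypotheses (s0 : 0 < s) (hL : adapted_norm A s C L).

Lemma adapted_ge0 x : 0 <= L x.
Proof. exact: le_trans (hnorm_ge0 ip x) (adapted_ge hL x). Qed.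

Lemma adapted_iter n x : L (iter n A x) <= s ^+ n * L x.
Proof.
elim: n => [|n IH]; first by rewrite /= expr0 mul1r.
by rewrite iterS exprS -mulrA; apply: (le_trans (adapted_contract hL _)); rewrite ler_pM2l.
Qed.

(** Neumann series in the norm L: its ratio is s / |z| < 1, even where |A| exceeds |z| in the
    original norm. *)
Lemma adapted_resolvent z : bounded_op ip A -> s < cmod z ->
  invertible_op ip (fun x => z *: x - A x).
Proof.
move=> hA sz; have linA := proj1 hA.
have [M [M0 hM]] := bounded_op_bound hA.
have z0 : 0 < cmod z := lt_trans s0 sz.
have zn0 : z != 0.
  by apply: contraTneq z0 => ->; rewrite /cmod ComplexField.Normc.normc0 ltxx.
pose th := s / cmod z.
have th0 : 0 <= th by rewrite divr_ge0// ltW.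
have th1 : th < 1 by rewrite ltr_pdivrMr// mul1r.
pose T x := z *: x - A x.
have linT : linear T.
  move=> a x y; rewrite /T linA scalerDr !scalerA mulrC opprD addrACA.
  by rewrite scalerBr scalerA.
have Tinj x : T x = 0 -> x = 0.
  move=> /subr0_eq Tx; apply: (hnorm_eq0 hH); apply/eqP.
  rewrite eq_le hnorm_ge0 andbT (le_trans (adapted_ge hL _))//.
  have := adapted_contract hL x; rewrite -Tx (adaptedZ hL).
  by have := adapted_ge0 x; nra.
(* Partial sums of the Neumann series, as fixed point iterates started at 0. *)
pose u x n := iter n (fun v => z^-1 *: (x + A v)) 0.
have uS x n : z *: u x n.+1 = x + A (u x n).
  by rewrite /= scalerA divff// scale1r.
pose K := C / cmod z.
have K0 : 0 <= K by rewrite divr_ge0 ?(adapted_const_ge0 hL)// ltW.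
have hu x n : N (u x n.+1 - u x n) <= K * N x * th ^+ n.
  apply: (le_trans (adapted_ge hL _)).
  elim: n => [|n IH].
    rewrite /= subr0 (linear0_map linA) addr0 (adaptedZ hL) mulr1 cmodV.
    by rewrite /K mulrAC [leRHS]mulrC ler_pM2l ?invr_gt0// (adapted_le hL).
  have -> : u x n.+2 - u x n.+1 = z^-1 *: A (u x n.+1 - u x n).
    by rewrite /= -scalerBr (linearB_map linA) opprD addrACA subrr add0r.
  rewrite (adaptedZ hL) cmodV mulrC ler_pdivrMr//.
  apply: (le_trans (adapted_contract hL _)).
  have -> : K * N x * th ^+ n.+1 * cmod z = s * (K * N x * th ^+ n).
    by rewrite exprS /th; field; rewrite gt_eqF.
  by rewrite ler_pM2l.
have /choice[S hS] : forall x, exists l, forall n, N (u x n - l) <= K * N x / (1 - th) * th ^+ n.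
  by move=> x; apply: (geometric_cvg hH) => //; rewrite mulr_ge0 ?hnorm_ge0.
have TS x : T (S x) = x.
  apply: (hnorm_small_eq hH) => e e0.
  pose D := K * N x / (1 - th).
  have D0 : 0 <= D by apply: divr_ge0; [rewrite mulr_ge0 ?hnorm_ge0 | rewrite subr_ge0 ltW].
  pose D1 := (cmod z + M) * D + 1.
  have D10 : 0 < D1 by rewrite ltr_wpDl// mulr_ge0// addr_ge0// ltW.
  have [n hn] := expr_small th0 th1 (divr_gt0 e0 D10).
  have -> : T (S x) - x = - (z *: (u x n.+1 - S x)) + A (u x n - S x).
    by rewrite /T scalerBr uS (linearB_map linA) opprB opprD (addrA (z *: S x)) subrKA addrAC.
  rewrite (le_trans (hnorm_triangle hH _ _))// (hnorm_opp hH) (hnorm_scale hH).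
  apply: (@le_trans _ _ ((cmod z + M) * D * th ^+ n)).
    rewrite mulrDl mulrDl lerD//.
      rewrite -mulrA ler_pM2l// (le_trans (hS _ _))// -/D.
      by rewrite exprS ler_wpM2l// ler_piMl ?exprn_ge0// ltW.
    by rewrite (le_trans (hM _))// -mulrA ler_pM2l// hS.
  move: hn; rewrite ltr_pdivlMr// /D1 => /ltW; apply: le_trans.
  by rewrite mulrC ler_wpM2l ?exprn_ge0// lerDl.
(* T is injective, so its right inverse is also a left inverse. *)
have ST x : S (T x) = x.
  by apply: subr0_eq; apply: Tinj; rewrite (linearB_map linT) TS subrr.
exists S; split=> //; split.
  by move=> a x y; rewrite -[in LHS](TS x) -[in LHS](TS y) -linT ST.
exists (K / (1 - th)) => x; have := hS x 0%N.
by rewrite expr0 mulr1 sub0r (hnorm_opp hH) mulrAC.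
Qed.

End Iterates.

(** Every spectral value has modulus at most s, and the gap s < t keeps the inequality strict after
    the supremum is taken. *)
Lemma spectral_radius_lt (A : H -> H) (t : R) n : 0 < t -> bounded_op ip A ->
  (forall x, N (iter n.+1 A x) <= 2^-1 * t ^+ n.+1 * N x) ->
  (spectral_radius ip A < t%:E)%E.
Proof.
move=> t0 hA hn; have [s [C [L [s0 st hL]]]] := exists_adapted_norm t0 hA hn.
apply: (@le_lt_trans _ _ s%:E); last by rewrite lte_fin.
apply: ge_ereal_sup => _ [z hz <-]; rewrite lee_fin leNgt; apply/negP => sz.
exact/hz/(adapted_resolvent s0 hL hA sz).
Qed.

End AdaptedNorm.

(** * Compactness of the closed complex disc *)

Section DiscCompactness.
Variable R : realType.
Implicit Types (z w : R[i]).

Lemma cmodN z : cmod (- z) = cmod z.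
Proof. by case: z => a b; rewrite /cmod /= !sqrrN. Qed.

Lemma cmodD z w : cmod (z + w) <= cmod z + cmod w.
Proof. exact: (@le_normcD R z w). Qed.

Lemma cmod_le_abs (a b : R) : cmod (Complex a b) <= `|a| + `|b|.
Proof.
rewrite -(@ler_pXn2r _ 2) ?nnegrE ?addr_ge0 ?cmod_ge0//.
rewrite /cmod /= sqr_sqrtr ?addr_ge0 ?sqr_ge0// sqrrD !real_normK ?num_real//.
by rewrite lerD2r lerDl mulrn_wge0// mulr_ge0.
Qed.

Lemma abs_le_cmod (a b : R) : `|a| <= cmod (Complex a b) /\ `|b| <= cmod (Complex a b).
Proof.
by split; rewrite -(@ler_pXn2r _ 2) ?nnegrE ?cmod_ge0// /cmod /=
  sqr_sqrtr ?addr_ge0 ?sqr_ge0// real_normK ?num_real// ?lerDl ?lerDr sqr_ge0.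
Qed.

(** Compactness of the square [-r, r]^2, in the near-covering form with M tending to +oo:
    monotonicity in M merges the local bounds into one. *)
Lemma disc_uniform_bound (r : R) (P : R -> R[i] -> Prop) :
  (forall M M' w, M <= M' -> P M w -> P M' w) ->
  (forall w, cmod w <= r -> exists M d, 0 < d /\
     forall w', cmod w' <= r -> cmod (w' - w) < d -> P M w') ->
  exists M, forall w, cmod w <= r -> P M w.
Proof.
move=> Pmono Ploc; pose toC (p : R * R) := Complex p.1 p.2.
have cpt : compact (`[-r, r]%classic `*` `[-r, r]%classic : set (R * R)).
  by apply: compact_setX; exact: segment_compact.
have : \forall M \near +oo, (`[-r, r]%classic `*` `[-r, r]%classic : set (R * R)) `<=`
    (fun p => cmod (toC p) <= r -> P M (toC p)).
  apply: (iffLR (compact_near_coveringP _) cpt R (pinfty_nbhs R)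
    (fun M p => cmod (toC p) <= r -> P M (toC p))) => p _.
  have [M [d [d0 hd]]] : exists M d, 0 < d /\ forall w', cmod (w' - toC p) < d ->
      cmod w' <= r -> P M w'.
    have [/Ploc[M [d [d0 h]]]|rp] := leP (cmod (toC p)) r.
      by exists M, d; split=> // w' ? ?; apply: h.
    (* A point of the square outside the disc has a neighbourhood that misses the disc, so any M
       will do. *)
    exists 0, (cmod (toC p) - r); split; first by rewrite subr_gt0.
    move=> w' hw' w'r; have := cmodD (toC p - w') w'; rewrite subrK.
    have -> : cmod (toC p - w') = cmod (w' - toC p).
      by rewrite -cmodN opprB.
    lra.
  (* Balls of R * R bound each coordinate separately and the modulus is at most the sum of the two,
     hence d / 2. *)
  exists (ball p (d / 2), [set M' | M < M']).
    by split=> /=; [apply: nbhsx_ballx; rewrite divr_gt0 | apply: nbhs_pinfty_gt; rewrite num_real].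
  move=> [p' M'] [/= [b1 b2] MM'] hp'; apply: (Pmono M); first exact: ltW.
  apply: hd => //; apply: (@le_lt_trans _ _ (`|p'.1 - p.1| + `|p'.2 - p.2|)).
    exact: cmod_le_abs.
  rewrite (splitr d) ltrD// distrC; [exact: b1 | exact: b2].
move=> [M0 [_ hM]]; exists (M0 + 1) => -[a b] hw.
have [ha hb] := abs_le_cmod a b.
apply: (hM (M0 + 1) _ (a, b)) => //=; first by rewrite ltrDl.
by split; rewrite /= in_itv /= -ler_norml (le_trans _ hw).
Qed.

End DiscCompactness.

(** * Inverses of 1 - (w A)^n under doubling of n *)

Section SpectralRadius.
Variables (R : realType) (H : lmodType R[i]) (ip : H -> H -> R[i]).
Hypothesis hH : is_separable_Hilbert ip.
Local Notation N := (hnorm ip).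

(** In the variable w = 1 / z the region |z| >= r, completed by w = 0, becomes the compact disc |w|
    <= 1 / r. *)
Definition pencil (A : H -> H) (n : nat) (w : R[i]) (x : H) : H :=
  x - w ^+ n *: iter n A x.

(** Factor 1 - X^2 as (1 - X)(1 + X) for G1 and as (1 + X)(1 - X) for G2: they return x + X x and x
    - X x, whose X terms cancel in the mean. *)
Lemma half_sum_inverse (X G1 G2 : H -> H) : linear X ->
  cancel (fun x => x - X x) G1 -> cancel G1 (fun x => x - X x) ->
  cancel (fun x => x + X x) G2 -> cancel G2 (fun x => x + X x) ->
  let G x := (2^-1 : R[i]) *: (G1 x + G2 x) in
  cancel (fun x => x - X (X x)) G /\ cancel G (fun x => x - X (X x)).
Proof.
move=> linX G1K KG1 G2K KG2 G.
have e1 x : x - X (X x) = (x + X x) - X (x + X x).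
  by rewrite (linearD_map linX) opprD addrA addrK.
have e2 x : x - X (X x) = (x - X x) + X (x - X x).
  by rewrite (linearB_map linX) addrA subrK.
have half x : (2^-1 : R[i]) *: (x + x) = x.
  by rewrite -mulr2n -[x *+ 2]scaler_nat scalerA mulVf ?scale1r// pnatr_eq0.
split=> x; rewrite /G.
  rewrite [in G1 _]e1 [in G2 _]e2 G1K G2K.
  by rewrite addrACA subrr addr0 half.
rewrite !(linearZ_map linX) -scalerBr !(linearD_map linX) opprD addrACA.
have -> : G1 x - X (X (G1 x)) = x + X x.
  by have KG1x : G1 x - X (G1 x) = x := KG1 x; rewrite e2 KG1x.
have -> : G2 x - X (X (G2 x)) = x - X x.
  by have KG2x : G2 x + X (G2 x) = x := KG2 x; rewrite e1 KG2x.
by rewrite addrACA subrr addr0 half.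
Qed.

(** Replacing w by z w changes the sign of (w A)^(2^k) without leaving the disc. Such a z comes from
    k successive square roots, starting at -1. *)
Lemma exists_root_opp1 k : exists2 z : R[i], z ^+ (2 ^ k) = -1 & cmod z = 1.
Proof.
have [z hz] : exists z : R[i], z ^+ (2 ^ k) = -1.
  elim: k => [|k [z hz]]; first by exists (-1).
  by exists (sqrtc z); rewrite expnS exprM sqr_sqrtc.
exists z => //; apply/eqP; rewrite -(@pexpr_eq1 _ _ (2 ^ k)) ?cmod_ge0 ?expn_gt0//.
by rewrite -cmodX hz cmodN /cmod ComplexField.Normc.normc1.
Qed.

Section Doubling.
Variables (A : H -> H) (r e c : R).
Hypothesis linA : linear A.

(** The last clause measures the change along a ray, from w to c w; the same e has to serve every
    exponent n = 2^k. *)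
Definition stable_inverse (n : nat) (F : R[i] -> H -> H) : Prop :=
  forall w, cmod w <= r ->
  [/\ cancel (pencil A n w) (F w), cancel (F w) (pencil A n w)
    & forall x, N (F w x - F ((c%:C)%C * w) x) <= e * N x].

(** The inverse for 2^(k+1) at w is the mean of those for 2^k at w and z w, and the mean of two
    changes bounded by e is again bounded by e. *)
Lemma stable_inverse_pow2 F k : stable_inverse 1 F -> exists G, stable_inverse (2 ^ k) G.
Proof.
move=> hF; elim: k => [|k [G hG]]; first by exists F.
have [z zk z1] := exists_root_opp1 k.
exists (fun w x => (2^-1 : R[i]) *: (G w x + G (z * w) x)) => w hw.
have hzw : cmod (z * w) <= r by rewrite cmodM z1 mul1r.
have [G1K KG1 G1N] := hG w hw; have [G2K KG2 G2N] := hG _ hzw.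
pose X x := w ^+ (2 ^ k) *: iter (2 ^ k) A x.
have linX : linear X.
  by move=> a x y; rewrite /X (linear_iter linA) scalerDr !scalerA mulrC.
have Xz x : pencil A (2 ^ k) (z * w) x = x + X x.
  by rewrite /pencil exprMn zk mulN1r scaleNr opprK.
have XX x : pencil A (2 ^ k.+1) w x = x - X (X x).
  rewrite /pencil /X (linearZ_map (linear_iter linA _)) scalerA -exprD -iterD.
  by rewrite expnS mul2n addnn.
have G2K' : cancel (fun x => x + X x) (G (z * w)) by move=> x; rewrite -Xz G2K.
have KG2' : cancel (G (z * w)) (fun x => x + X x) by move=> x; rewrite -Xz KG2.
have [h1 h2] := half_sum_inverse linX G1K KG1 G2K' KG2'.
split=> x; first by rewrite XX h1.
  by rewrite XX h2.
rewrite -scalerBr (hnorm_scale hH) opprD addrACA.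
have -> : cmod (2^-1 : R[i]) = 2^-1.
  by rewrite cmodV -[2 : R[i]](rmorph_nat (real_complex R)) cmod_real ger0_norm.
have h : N (G w x - G (c%:C%C * w) x + (G (z * w) x - G (z * (c%:C%C * w)) x)) <= e * N x + e * N x.
  by rewrite (le_trans (hnorm_triangle hH _ _))// lerD// mulrCA.
by rewrite ler_pdivrMl//; lra.
Qed.

End Doubling.

End SpectralRadius.

(** * From the resolvent to the size of the powers of A *)

Section Gelfand.
Variables (R : realType) (H : lmodType R[i]) (ip : H -> H -> R[i]) (A : H -> H).
Hypotheses (hH : is_separable_Hilbert ip) (hA : bounded_op ip A).
Local Notation N := (hnorm ip).
Implicit Types (r c e t M : R).

(** The bound on an inverse survives small perturbations, and compactness makes it uniform. It is
    phrased as a lower bound on the pencil so as not to depend on a chosen inverse. *)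
Lemma pencil1_lower_bound r :
  (forall w, cmod w <= r -> invertible_op ip (pencil A 1 w)) ->
  exists M, forall w, cmod w <= r -> forall y, N y <= M * N (pencil A 1 w y).
Proof.
move=> hinv; have [MA [MA0 hMA]] := bounded_op_bound hA.
apply: disc_uniform_bound => [M M' w MM' h y|w hw].
  by rewrite (le_trans (h y))// ler_wpM2r ?hnorm_ge0.
have [S [bS SK _]] := hinv w hw; have [M [M0 hM]] := bounded_op_bound bS.
have MM : 0 < M * MA by rewrite mulr_gt0.
(* At this distance the perturbation (w' - w) A, after multiplication by M, costs at most |y| / 2;
   absorbing it doubles M. *)
exists (2 * M), (2 * (M * MA))^-1; split; first by rewrite invr_gt0 mulr_gt0.
move=> w' _ hw' y.
have e1 : pencil A 1 w y = pencil A 1 w' y + (w' - w) *: A y.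
  by rewrite /pencil !expr1 /= scalerBl addrA subrK.
have h1 : N y <= M * N (pencil A 1 w y) by rewrite -{1}(SK y) hM.
have h2 : N (pencil A 1 w y) <= N (pencil A 1 w' y) + cmod (w' - w) * (MA * N y).
  rewrite e1 (le_trans (hnorm_triangle hH _ _))// lerD2l (hnorm_scale hH).
  by rewrite ler_wpM2l ?cmod_ge0.
have h3 : cmod (w' - w) * (M * MA) * N y <= 2^-1 * N y.
  rewrite ler_wpM2r ?hnorm_ge0// -ler_pdivlMr// -invfM ltW//.
have h4 : M * N (pencil A 1 w y) <=
    M * (N (pencil A 1 w' y) + cmod (w' - w) * (MA * N y)) by rewrite ler_pM2l.
nra.
Qed.

(** The factor 1/2 is the one in [exists_adapted_norm]; the exponents are those reached by
    doubling. *)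
Definition pow2_small t := exists k, forall x,
  N (iter (2 ^ k) A x) <= 2^-1 * t ^+ (2 ^ k) * N x.

(** Two more doublings raise 1/2 to the fourth power, and 1/16 <= 1/8. *)
Lemma pow2_small_eighth t : 0 <= t -> pow2_small t -> exists k, forall x,
  N (iter (2 ^ k) A x) <= 8^-1 * t ^+ (2 ^ k) * N x.
Proof.
move=> t0 [k hk]; exists k.+2 => x.
have e4 : (2 ^ k.+2 = 4 * 2 ^ k)%N by rewrite !expnS mulnA.
have q0 : 0 <= 2^-1 * t ^+ (2 ^ k) by rewrite mulr_ge0 ?exprn_ge0.
rewrite e4 iterM (le_trans (hnorm_iter q0 hk _ _))//.
rewrite ler_wpM2r ?hnorm_ge0// exprMn -exprM mulnC ler_wpM2r ?exprn_ge0//; lra.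
Qed.

(** G x - x = (w A)^n G x; then |G x| <= |G x - x| + |x| is solved for |G x - x|. *)
Lemma pencil_near_id n w d (G : H -> H) : 0 <= d < 1 ->
  cancel G (pencil A n w) -> (forall x, N (w ^+ n *: iter n A x) <= d * N x) ->
  forall x, N (G x - x) <= d / (1 - d) * N x.
Proof.
move=> /andP[d0 d1] KG hd x.
have e1 : G x - x = w ^+ n *: iter n A (G x).
  by rewrite -{2}(KG x) /pencil opprB addrC subrK.
have h1 : N (G x - x) <= d * N (G x) by rewrite e1.
have h2 : N (G x) <= N (G x - x) + N x by rewrite -{1}(subrK x (G x)) hnorm_triangle.
rewrite mulrAC ler_pdivlMr ?subr_gt0//; nra.
Qed.

(** Way back from the previous estimate: at the point (1 - (w A)^n) x the difference G - id takes
    the value (w A)^n x. *)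
Lemma near_id_pencil n w d (G : H -> H) : 0 <= d < 1 ->
  cancel (pencil A n w) G -> (forall x, N (G x - x) <= d * N x) ->
  forall x, N (w ^+ n *: iter n A x) <= d / (1 - d) * N x.
Proof.
move=> /andP[d0 d1] GK hd x; have := hd (pencil A n w x).
rewrite GK /pencil opprB addrC subrK => h1.
have h2 := hnorm_sub_le hH x (w ^+ n *: iter n A x).
rewrite mulrAC ler_pdivlMr ?subr_gt0//; nra.
Qed.

(** At c w = 1 / t the bound 1/8 puts the inverse within (1/8) / (7/8) = 1/7 of the identity. Moving
    to w = 1 / (c t) adds 1/8, and 1/7 + 1/8 < 1/3. Going back, (1/3) / (2/3) = 1/2. The condition r
    <= c t keeps w in the disc. *)
Lemma pow2_small_step r c t F : 0 < c < 1 -> 0 < r -> r <= c * t ->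
  stable_inverse ip A r^-1 8^-1 c 1 F -> pow2_small t -> pow2_small (c * t).
Proof.
move=> /andP[c0 c1] r0 rct hF ht.
have ct0 : 0 < c * t by apply: lt_le_trans rct.
have t0 : 0 < t by move: ct0; rewrite pmulr_rgt0.
have [k hk] := pow2_small_eighth (ltW t0) ht; exists k.
have [G hG] := stable_inverse_pow2 hH (proj1 hA) k hF.
pose w := (((c * t)^-1)%:C)%C.
have wc : cmod w = (c * t)^-1 by rewrite cmod_real ger0_norm// invr_ge0 ltW.
have wr : cmod w <= r^-1 by rewrite wc lef_pV2.
have cw : (c%:C)%C * w = ((t^-1)%:C)%C.
  by rewrite /w -rmorphM; congr (_ %:C)%C; field; rewrite !gt_eqF.
have cwr : cmod ((c%:C)%C * w) <= r^-1.
  by rewrite cmodM cmod_real ger0_norm ?(ltW c0)// (le_trans _ wr)// ler_piMl ?cmod_ge0// ltW.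
have [GK KG Gc] := hG w wr; have [_ KG' _] := hG _ cwr.
have e7 : 8^-1 / (1 - 8^-1) = 7^-1 :> R by field.
have e2 : 3^-1 / (1 - 3^-1) = 2^-1 :> R by field.
have h1 x : N (G ((c%:C)%C * w) x - x) <= 7^-1 * N x.
  rewrite -e7.
  apply: (pencil_near_id _ KG') => [|y]; first by apply/andP; split; lra.
  rewrite cw (hnorm_scale hH) cmodX cmod_real ger0_norm ?invr_ge0 ?(ltW t0)//.
  by rewrite exprVn mulrC ler_pdivrMr ?exprn_gt0// mulrAC.
have h2 x : N (G w x - x) <= 3^-1 * N x.
  rewrite -(subrKA (G ((c%:C)%C * w) x)) (le_trans (hnorm_triangle hH _ _))//.
  by have := hnorm_ge0 ip x; have := h1 x; have := Gc x; nra.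
move=> x; have := near_id_pencil _ GK h2 x.
rewrite (hnorm_scale hH) cmodX wc exprVn mulrC ler_pdivrMr ?exprn_gt0// => /(_ _)/le_trans; apply.
  by apply/andP; split; lra.
by rewrite e2 mulrAC.
Qed.

Lemma pow2_small_of_resolvent r : 0 < r ->
  (forall w, cmod w <= r^-1 -> invertible_op ip (pencil A 1 w)) -> pow2_small r.
Proof.
move=> r0 hinv; have [MA [MA0 hMA]] := bounded_op_bound hA.
have [M hM] := pencil1_lower_bound hinv.
have /choice[F hF] w : exists S : H -> H, cmod w <= r^-1 ->
    [/\ bounded_op ip S, cancel (pencil A 1 w) S & cancel S (pencil A 1 w)].
  have [/hinv[S hS]|_] := boolP (cmod w <= r^-1); first by exists S.
  by exists id.
(* The resolvent identity F w - F (c w) = (1 - c) w F w A F (c w) bounds the change by (1 - c) K; e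
   = 1 - c is chosen to bring this below 1/8. *)
pose K := r^-1 * MA * `|M| ^+ 2.
have K0 : 0 <= K by rewrite !mulr_ge0 ?exprn_ge0// ?ltW// invr_gt0.
pose e := (8 * (K + 1))^-1.
have K1 : 0 < 8 * (K + 1) by lra.
have e0 : 0 < e by rewrite invr_gt0.
have eK : e * K <= 8^-1 by rewrite mulrC ler_pdivrMr//; lra.
have e1 : e <= 8^-1 by rewrite lef_pV2// ?posrE//; lra.
pose c := 1 - e.
have c0 : 0 < c by rewrite /c; lra.
have c1 : c < 1 by rewrite /c; lra.
have Fb w x : cmod w <= r^-1 -> N (F w x) <= `|M| * N x.
  move=> hw; have [_ _ KF] := hF w hw.
  rewrite -{2}(KF x) (le_trans (hM w hw _))// ler_wpM2r ?hnorm_ge0// ler_norm//.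
have stF : stable_inverse ip A r^-1 8^-1 c 1 F.
  move=> w hw; have [[linF _] FK KF] := hF w hw; split=> // x.
  have cwr : cmod ((c%:C)%C * w) <= r^-1.
    by rewrite cmodM cmod_real ger0_norm ?(ltW c0)// (le_trans _ hw)// ler_piMl ?cmod_ge0// ltW.
  have [_ _ KF'] := hF _ cwr; set y := F ((c%:C)%C * w) x.
  have ex : x = pencil A 1 w y + (((e%:C)%C * w) *: A y).
    rewrite -{1}(KF' x) -/y /pencil !expr1 /= -addrA; congr (_ + _).
    rewrite -scaleNr -[in RHS]scaleNr -scalerDl; congr (_ *: _).
    by rewrite /c rmorphB rmorph1; ring.
  rewrite {1}ex (linearD_map linF) FK addrC addKr (linearZ_map linF) (hnorm_scale hH).
  rewrite cmodM cmod_real ger0_norm ?(ltW e0)//.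
  have h1 := Fb w (A y) hw; have h2 := hMA y; have h3 : N y <= `|M| * N x := Fb _ x cwr.
  have h4 : N (F w (A y)) <= `|M| * (MA * (`|M| * N x)).
    rewrite (le_trans h1)// ler_wpM2l// (le_trans h2)// ler_pM2l//.
  have h5 : e * cmod w * N (F w (A y)) <= e * r^-1 * (`|M| * (MA * (`|M| * N x))).
    by rewrite ler_pM ?mulr_ge0 ?cmod_ge0 ?hnorm_ge0 ?ler_pM2l// ltW.
  rewrite (le_trans h5)//.
  have -> : e * r^-1 * (`|M| * (MA * (`|M| * N x))) = e * K * N x by rewrite /K; ring.
  by rewrite ler_wpM2r ?hnorm_ge0.
(* Descent from r / c^m to r in m steps of ratio c. *)
have step m : pow2_small (r / c ^+ m) -> pow2_small r.
  elim: m => [|m IH]; first by rewrite expr0 divr1.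
  have ee : c * (r / c ^+ m.+1) = r / c ^+ m.
    by rewrite exprS; field; rewrite ?expf_neq0 ?gt_eqF.
  move=> h; apply: IH; rewrite -ee; apply: (pow2_small_step (r := r) _ r0 _ stF h).
    by rewrite c0 c1.
  by rewrite ee ler_pdivlMr ?exprn_gt0// ler_piMr ?exprn_ile1 ?ltW.
(* For c^m < r / (2 [MA]) the start t = r / c^m exceeds 2 [MA], so the exponent 2^0 = 1 already
   works there. *)
have [m hm] := expr_small (ltW c0) c1 (divr_gt0 r0 (mulr_gt0 (ltr0n _ 2) MA0)).
apply: (step m); exists 0%N => x; rewrite expn0 expr1 /=.
rewrite (le_trans (hMA x))// ler_wpM2r ?hnorm_ge0//.
rewrite mulrA ler_pdivlMr ?exprn_gt0//.
by move: hm; rewrite ltr_pdivlMr ?mulr_gt0// => /ltW; lra.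
Qed.

(** For w != 0, 1 - w A = w (1/w - A), and |1/w| >= r is beyond the spectral radius; at w = 0 the
    pencil is the identity. *)
Lemma pow2_small_of_spectral_radius r : 0 < r ->
  (spectral_radius ip A < r%:E)%E -> pow2_small r.
Proof.
move=> r0 hr; apply: pow2_small_of_resolvent => // w hw.
have linA := proj1 hA.
have [->|w0] := eqVneq w 0.
  exists id; split=> [|x|x]; rewrite ?/pencil ?expr1 ?scale0r ?subr0//.
  by split=> //; exists 1 => x; rewrite mul1r.
have [S [[linS [M hM]] SK KS]] : invertible_op ip (fun x => w^-1 *: x - A x).
  apply: contrapT => hz; move: hr; apply/negP.
  rewrite -leNgt; apply: (@le_trans _ _ (cmod w^-1)%:E).
    by rewrite lee_fin cmodV -[leLHS]invrK lef_pV2// ?posrE ?invr_gt0 ?cmod_gt0.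
  by apply: ereal_sup_ubound; exists w^-1.
have e1 x : pencil A 1 w x = w *: (w^-1 *: x - A x).
  by rewrite /pencil expr1 scalerBr scalerA divff// scale1r.
exists (fun x => S (w^-1 *: x)); split=> [|x|x].
- split; first by move=> a x y; rewrite scalerDr scalerA mulrC -scalerA linS.
  exists (M * cmod w^-1) => x.
  by rewrite (le_trans (hM _))// (hnorm_scale hH) mulrA.
- by rewrite e1 scalerA mulVf// scale1r SK.
- by rewrite e1 KS scalerA divff// scale1r.
Qed.

End Gelfand.

(** * Weighted l_2 sequences *)

Section WeightedL2.
Variables (R : realType) (H : lmodType R[i]) (ip : H -> H -> R[i]) (rho : R).
Hypotheses (hH : is_separable_Hilbert ip) (rho0 : 0 < rho).
Local Notation N := (hnorm ip).
Implicit Types (f g h : int -> H) (k p : int).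

Definition l2_term f k : R := (N (f k) * rho ^ (- k)) ^+ 2.

Lemma l2_term_ge0 f k : 0 <= l2_term f k.
Proof. exact: sqr_ge0. Qed.

Lemma l2w_sumE f : l2w_sum ip rho f = \esum_(k in [set: int]) (l2_term f k)%:E.
Proof.
apply: eq_esum => k _; congr (_%:E); rewrite /l2_term exprMn; congr (_ * _).
by rewrite exprnP exprz_exp; congr (_ ^ _); lia.
Qed.

Lemma l2w_sum_ge0 f : (0 <= l2w_sum ip rho f)%E.
Proof. by rewrite l2w_sumE; apply: esum_ge0 => k _; rewrite lee_fin l2_term_ge0. Qed.

Let seg p n : seq int := [seq p + i%:Z | i <- iota 0 n].

Let fsum_seg f p n : (\sum_(k \in [set` seg p n]) (l2_term f k)%:E)%E =
  (\sum_(i < n) l2_term f (p + i%:Z))%:E.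
Proof.
rewrite -fsbig_seq ?map_inj_uniq ?iota_uniq//; last by move=> i j /addrI[].
by rewrite big_map sumEFin -[n in iota 0 n]subn0 -/(index_iota 0 n) big_mkord.
Qed.

Lemma l2w_sum_ge f p n : ((\sum_(i < n) l2_term f (p + i%:Z))%:E <= l2w_sum ip rho f)%E.
Proof.
rewrite l2w_sumE -fsum_seg; apply: esum_ge; exists [set` seg p n] => //.
by split => //; exact: finite_seq.
Qed.

(** Every finite set of integers lies in some interval [-m, m], so for nonnegative terms sums over
    intervals suffice. *)
Lemma l2w_sum_le f (G : R) : (forall p n, \sum_(i < n) l2_term f (p + i%:Z) <= G) ->
  (l2w_sum ip rho f <= G%:E)%E.
Proof.
move=> hG; rewrite l2w_sumE; apply: ge_ereal_sup => _ [X [finX _] <-].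
have [s Xs] := (finite_seqP X).1 finX.
pose m := \max_(k <- s) `|k|%N.
apply: (@le_trans _ _ (\sum_(k \in [set` seg (- m%:Z) (m + m).+1]) (l2_term f k)%:E)%E).
  apply: lee_fsum_nneg_subset => //; first exact: finite_seq.
    move=> k; rewrite Xs !inE /= => ks.
    have km : (`|k|%N <= m)%N by apply: leq_bigmax_seq.
    move: (k : int) km => j jm.
    apply/mapP; exists (absz (j + m%:Z)); last by lia.
    by rewrite mem_iota; lia.
  by move=> k _; rewrite lee_fin l2_term_ge0.
by rewrite fsum_seg lee_fin.
Qed.

Lemma l2norm_ge0 f : 0 <= l2norm ip rho f.
Proof. exact: sqrtr_ge0. Qed.

Lemma l2_term_sum_le f p n : in_l2 ip rho f ->
  \sum_(i < n) l2_term f (p + i%:Z) <= l2norm ip rho f ^+ 2.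
Proof.
move=> lf; rewrite sqr_sqrtr; last by rewrite fine_ge0 ?l2w_sum_ge0.
rewrite -lee_fin fineK ?l2w_sum_ge// ge0_fin_numE ?l2w_sum_ge0//.
Qed.

Lemma in_l2_of_sum_le f G : (forall p n, \sum_(i < n) l2_term f (p + i%:Z) <= G) ->
  in_l2 ip rho f.
Proof. by move=> /l2w_sum_le/le_lt_trans; apply; rewrite ltry. Qed.

Lemma l2norm_le_of_sum_le f (G : R) : 0 <= G ->
  (forall p n, \sum_(i < n) l2_term f (p + i%:Z) <= G ^+ 2) -> l2norm ip rho f <= G.
Proof.
move=> G0 hG; have lf := in_l2_of_sum_le hG.
rewrite -[leRHS]ger0_norm// -sqrtr_sqr ler_sqrt ?sqr_ge0// -lee_fin fineK ?l2w_sum_le//.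
by rewrite ge0_fin_numE ?l2w_sum_ge0.
Qed.

Lemma l2_pointwise f k : in_l2 ip rho f -> N (f k) <= l2norm ip rho f * rho ^ k.
Proof.
move=> lf; have := l2_term_sum_le k 1 lf; rewrite big_ord1 addr0 /l2_term.
rewrite ler_pXn2r ?nnegrE ?l2norm_ge0 ?mulr_ge0 ?hnorm_ge0 ?exprz_ge0 ?(ltW rho0)//.
by rewrite -invr_expz ler_pdivrMr ?exprz_gt0.
Qed.

(** The shift by d costs a factor rho^d. The case d = 0 serves linear combinations, d = 1 serves tau
    - A. *)
Lemma in_l2_dominated f g h (c c' : R) (d : int) : 0 <= c -> 0 <= c' ->
  in_l2 ip rho f -> in_l2 ip rho g ->
  (forall k, N (h k) <= c * N (f (k + d)) + c' * N (g k)) -> in_l2 ip rho h.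
Proof.
move=> c0 c0' lf lg hh; pose b := c * rho ^ d.
have b0 : 0 <= b by rewrite mulr_ge0// exprz_ge0 ?ltW.
have term k : l2_term h k <= 2 * b ^+ 2 * l2_term f (k + d) + 2 * c' ^+ 2 * l2_term g k.
  have rk : 0 <= rho ^ (- k) by rewrite exprz_ge0// ltW.
  have le1 : N (h k) * rho ^ (- k) <=
      b * (N (f (k + d)) * rho ^ (- (k + d))) + c' * (N (g k) * rho ^ (- k)).
    rewrite (le_trans (ler_wpM2r rk (hh k)))// mulrDl lerD ?mulrA//.
    have -> : rho ^ (- k) = rho ^ d * rho ^ (- (k + d)).
      by rewrite -expfzDr ?gt_eqF//; congr (_ ^ _); ring.
    by rewrite /b le_eqVlt; apply/orP; left; apply/eqP; ring.
  rewrite /l2_term; move: le1.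
  set u := N (h k) * _; set v := N (f _) * _; set w := N (g k) * _ => le1.
  have u0 : 0 <= u by rewrite mulr_ge0 ?hnorm_ge0.
  have : u ^+ 2 <= (b * v + c' * w) ^+ 2 by rewrite lerXn2r ?nnegrE// (le_trans u0).
  by have := sqr_ge0 (b * v - c' * w); nra.
apply: (@in_l2_of_sum_le _ (2 * b ^+ 2 * l2norm ip rho f ^+ 2 +
  2 * c' ^+ 2 * l2norm ip rho g ^+ 2)).
move=> p n; apply: (le_trans (ler_sum _ (fun i _ => term _))).
have sf : \sum_(i < n) l2_term f (p + i%:Z + d) <= l2norm ip rho f ^+ 2.
  by under eq_bigr do rewrite addrAC; apply: l2_term_sum_le.
have sg := l2_term_sum_le p n lg.
rewrite big_split /= -!mulr_sumr.
by apply: lerD; rewrite ler_wpM2l// mulr_ge0 ?sqr_ge0.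
Qed.

Lemma in_l2_lin (a : R[i]) f g : in_l2 ip rho f -> in_l2 ip rho g ->
  in_l2 ip rho (fun k => a *: f k + g k).
Proof.
move=> lf lg; apply: (@in_l2_dominated f g _ (cmod a) 1 0) => //; first exact: cmod_ge0.
by move=> k; rewrite addr0 mul1r -(hnorm_scale hH) hnorm_triangle.
Qed.

Lemma in_l2_tau_minus (A : H -> H) f : bounded_op ip A -> in_l2 ip rho f ->
  in_l2 ip rho (tau_minus A f).
Proof.
move=> /bounded_op_bound[M [M0 hM]] lf.
apply: (@in_l2_dominated f f _ 1 M 1) => //; first exact: ltW.
by move=> k; rewrite mul1r (le_trans (hnorm_sub_le hH _ _))// lerD2l.
Qed.

Lemma geometric_eq0 (x : H) (D c : R) : 0 <= c -> c < 1 ->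
  (forall n, N x <= D * c ^+ n) -> x = 0.
Proof.
move=> c0 c1 hx; apply: (hnorm_small_eq hH) => e e0; rewrite subr0.
have D1 : 0 < `|D| + 1 by rewrite ltr_wpDl.
have [n hn] := expr_small c0 c1 (divr_gt0 e0 D1).
move: hn; rewrite ltr_pdivlMr// => /ltW; apply: le_trans.
rewrite (le_trans (hx n))// mulrC ler_wpM2l ?exprn_ge0//.
by rewrite (le_trans (ler_norm D))// lerDl.
Qed.

(** * The causal solution of (tau - A) y = f *)

Section Solution.
Variables (A : H -> H) (s C : R) (L : H -> R).
Hypotheses (hA : bounded_op ip A) (s0 : 0 < s) (srho : s < rho).
Hypothesis hL : adapted_norm ip A s C L.
Let th := s / rho.

Let th0 : 0 <= th. Proof. by rewrite divr_ge0// ltW. Qed.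
Let th1 : th < 1. Proof. by rewrite ltr_pdivrMr// mul1r. Qed.
Let C0 : 0 <= C. Proof. exact: adapted_const_ge0 hL. Qed.

(** A homogeneous solution satisfies y_k = A^n y_(k-n) for every n. Here |y_(k-n)| is at most a
    multiple of rho^(k-n), while A^n contributes s^n, so y_k is of order (s / rho)^n. *)
Lemma tau_minus_inj y : in_l2 ip rho y -> tau_minus A y = (fun=> 0) -> y = (fun=> 0).
Proof.
move=> ly hy; apply/funext => k.
have yS j : y (j + 1) = A (y j) by apply/subr0_eq; have := congr1 (@^~ j) hy.
have yit n : y k = iter n A (y (k - n%:Z)).
  elim: n => [|n ->]; first by rewrite subr0.
  rewrite iterSr -yS; congr (iter _ _ (y _)); lia.
apply: (@geometric_eq0 _ (C * l2norm ip rho y * rho ^ k) th) => // n.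
rewrite (le_trans (adapted_ge hL _))// {1}(yit n).
rewrite (le_trans (adapted_iter s0 hL _ _))//.
have -> : C * l2norm ip rho y * rho ^ k * th ^+ n =
    s ^+ n * (C * (l2norm ip rho y * rho ^ (k - n%:Z))).
  rewrite expfzDr ?gt_eqF// -invr_expz -exprnP /th expr_div_n.
  by field; rewrite expf_neq0// gt_eqF.
rewrite ler_pM2l ?exprn_gt0// (le_trans (adapted_le hL _))// ler_wpM2l//.
exact: l2_pointwise.
Qed.

(** Telescoping; the end term a_(p+n) stays on the left so that the induction closes. *)
Lemma affine_recursion_sum (a b : int -> R) p n :
  (forall k, a (k + 1) <= th * a k + b k) ->
  (1 - th) * \sum_(i < n) a (p + i%:Z) + a (p + n%:Z) <= a p + \sum_(i < n) b (p + i%:Z).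
Proof.
move=> hab; elim: n => [|n IH]; first by rewrite !big_ord0 mulr0 add0r !addr0.
rewrite !big_ord_recr /=; have := hab (p + n%:Z).
by rewrite -addrA -PoszD addn1; move: IH; nra.
Qed.

(** The last clause has k <= a and not k < a because y_k involves only the f_j with j < k. *)
Lemma tau_minus_solution f : in_l2 ip rho f -> exists y,
  [/\ tau_minus A y = f,
      forall k, N (y k) <= C * l2norm ip rho f * rho ^ (k - 1) / (1 - th)
    & forall a : int, (forall k, k < a -> f k = 0) -> forall k, k <= a -> y k = 0].
Proof.
move=> lf; have linA := proj1 hA.
set F := l2norm ip rho f; have F0 : 0 <= F := l2norm_ge0 f.
(* [u n k] is the sum of A^j f_(k-1-j) over j < n. *)
pose u := fix u (n : nat) k := if n is n'.+1 then A (u n' (k - 1)) + f (k - 1) else 0.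
pose D k := C * F * rho ^ (k - 1).
have D0 k : 0 <= D k by rewrite !mulr_ge0// exprz_ge0 ?ltW.
have hu n k : N (u n.+1 k - u n k) <= D k * th ^+ n.
  rewrite (le_trans (adapted_ge hL _))//.
  elim: n k => [|n IH] k.
    rewrite /= subr0 (linear0_map linA) add0r mulr1 (le_trans (adapted_le hL _))//.
    by rewrite /D -mulrA ler_wpM2l// l2_pointwise.
  have -> : u n.+2 k - u n.+1 k = A (u n.+1 (k - 1) - u n (k - 1)).
    by rewrite (linearB_map linA) /= opprD addrACA subrr addr0.
  rewrite (le_trans (adapted_contract hL _))//.
  have -> : D k * th ^+ n.+1 = s * (D (k - 1) * th ^+ n).
    rewrite /D exprS /th (expfzDr (k - 1)) ?gt_eqF// exprN1.
    by ring.
  by rewrite ler_pM2l.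
have /choice[y hy] k : exists l, forall n, N (u n k - l) <= D k / (1 - th) * th ^+ n.
  exact: (geometric_cvg hH (u := fun n => u n k) (D0 k) th0 th1 (hu^~ k)).
exists y; split.
- apply/funext => k; apply/subr0_eq.
  have [M [M0 hM]] := bounded_op_bound hA.
  apply: (@geometric_eq0 _ (D (k + 1) / (1 - th) + M * (D k / (1 - th))) th) => // n.
  have -> : tau_minus A y k - f k = - (u n.+1 (k + 1) - y (k + 1)) + A (u n k - y k).
    rewrite (linearB_map linA) /= addrK opprB opprD /tau_minus.
    by rewrite [- A _ - _]addrC (addrA (y (k + 1))) subrKA addrAC.
  rewrite (le_trans (hnorm_triangle hH _ _))// (hnorm_opp hH) mulrDl lerD//.
    rewrite (le_trans (hy _ _))// exprS ler_wpM2l//.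
      by rewrite divr_ge0// subr_ge0 (ltW th1).
    by rewrite ler_piMl ?exprn_ge0// ltW.
  by rewrite (le_trans (hM _))// -mulrA ler_pM2l.
- move=> k; have := hy k 0%N.
  by rewrite expr0 mulr1 sub0r (hnorm_opp hH).
move=> a fa k ka.
have u0 n : forall j, j <= a -> u n j = 0.
  elim: n => [|n IH] j ja //=.
  by rewrite IH ?fa ?(linear0_map linA) ?addr0//; lia.
apply: (@geometric_eq0 _ (D k / (1 - th)) th) => // n.
by have := hy k n; rewrite u0// sub0r (hnorm_opp hH).
Qed.

(** The weighted squares a_k of L (y_k) satisfy a_(k+1) <= th a_k + C1 |f_k|^2 rho^(-2k); summed
    over an interval this bounds the sum of the a_k up to the initial term a_p. The pointwise
    hypothesis bounds a_p uniformly in p. *)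
Lemma solution_l2norm : exists2 K : R, 0 <= K & forall f y, in_l2 ip rho f ->
  tau_minus A y = f ->
  (forall k, N (y k) <= C * l2norm ip rho f * rho ^ (k - 1) / (1 - th)) ->
  in_l2 ip rho y /\ l2norm ip rho y <= K * l2norm ip rho f.
Proof.
have d0 : 0 < 1 - th by rewrite subr_gt0.
pose C1 := (rho^-1 * C) ^+ 2 / (1 - th); pose C2 := (C * C / rho / (1 - th)) ^+ 2.
have C10 : 0 <= C1 by rewrite divr_ge0 ?sqr_ge0 ?ltW.
have C20 : 0 <= C2 by rewrite sqr_ge0.
have C30 : 0 <= (C2 + C1) / (1 - th).
  by apply: divr_ge0; [exact: addr_ge0 | exact: ltW].
exists (Num.sqrt ((C2 + C1) / (1 - th))) => [|f y lf hy yb]; first exact: sqrtr_ge0.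
pose a k := (L (y k) * rho ^ (- k)) ^+ 2.
have r0 k : 0 < rho ^ k by rewrite exprz_gt0.
have L0 x : 0 <= L x := adapted_ge0 hL x.
have arec k : a (k + 1) <= th * a k + C1 * l2_term f k.
  have h1 : L (y (k + 1)) * rho ^ (- (k + 1)) <=
      th * (L (y k) * rho ^ (- k)) + rho^-1 * C * (N (f k) * rho ^ (- k)).
    have -> : y (k + 1) = A (y k) + f k by rewrite -hy /tau_minus addrCA subrr addr0.
    rewrite opprD expfzDr ?gt_eqF// exprN1 [leLHS]mulrA ler_pdivrMr//.
    have -> : (th * (L (y k) * rho ^ (- k)) + rho^-1 * C * (N (f k) * rho ^ (- k))) * rho =
        (s * L (y k) + C * N (f k)) * rho ^ (- k).
      by rewrite /th; field; rewrite gt_eqF.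
    rewrite ler_pM2r// (le_trans (adaptedD hL _ _))// lerD//.
      exact: (adapted_contract hL).
    exact: (adapted_le hL).
  rewrite /a /l2_term; move: h1.
  set u := L (y (k + 1)) * _; set v := L (y k) * _; set w := N (f k) * _ => h1.
  have u0 : 0 <= u by rewrite mulr_ge0// ltW.
  have h2 : u ^+ 2 <= (th * v + rho^-1 * C * w) ^+ 2 by rewrite lerXn2r ?nnegrE// (le_trans u0).
  apply: (le_trans h2); rewrite -subr_ge0.
  (* Convexity with weights th and 1 - th, which is where [C1] comes from; the defect is written as
     a square. *)
  have -> : th * v ^+ 2 + C1 * w ^+ 2 - (th * v + rho^-1 * C * w) ^+ 2 =
      th / (1 - th) * ((1 - th) * v - rho^-1 * C * w) ^+ 2.
    rewrite /C1; move: (rho^-1 * C) => q; field; rewrite gt_eqF//.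
  by rewrite mulr_ge0 ?sqr_ge0// divr_ge0// ltW.
have a_bound k : a k <= C2 * l2norm ip rho f ^+ 2.
  rewrite /a /C2 -exprMn lerXn2r ?nnegrE ?mulr_ge0 ?invr_ge0 ?l2norm_ge0
    ?(ltW d0) ?(ltW (r0 _)) ?(ltW rho0)//.
  rewrite -invr_expz ler_pdivrMr// (le_trans (adapted_le hL _))//.
  rewrite (le_trans (ler_wpM2l C0 (yb k)))// expfzDr ?gt_eqF// exprN1.
  by rewrite le_eqVlt; apply/orP; left; apply/eqP; ring.
have sumb p n : \sum_(i < n) l2_term y (p + i%:Z) <=
    (Num.sqrt ((C2 + C1) / (1 - th)) * l2norm ip rho f) ^+ 2.
  rewrite exprMn sqr_sqrtr// mulrAC ler_pdivlMr//.
  apply: (@le_trans _ _ ((1 - th) * \sum_(i < n) a (p + i%:Z))).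
    rewrite mulrC ler_pM2l// ler_sum// => i _.
    rewrite /l2_term /a lerXn2r ?nnegrE ?mulr_ge0 ?hnorm_ge0 ?(ltW (r0 _))//.
    by rewrite ler_pM2r// (adapted_ge hL).
  have := affine_recursion_sum p n arec; rewrite -mulr_sumr.
  have h1 : 0 <= a (p + n%:Z) by rewrite sqr_ge0.
  have h2 := a_bound p.
  have h3 : C1 * \sum_(i < n) l2_term f (p + i%:Z) <= C1 * l2norm ip rho f ^+ 2.
    by rewrite ler_wpM2l// l2_term_sum_le.
  by rewrite mulrDl; lra.
split; first exact: in_l2_of_sum_le sumb.
by apply: l2norm_le_of_sum_le => //; rewrite mulr_ge0 ?sqrtr_ge0.
Qed.

End Solution.
End WeightedL2.

(** * The three implications *)

Section Equivalence.
Variables (R : realType) (H : lmodType R[i]) (ip : H -> H -> R[i]) (rho : R).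
Variable A : H -> H.
Hypotheses (hH : is_separable_Hilbert ip) (rho0 : 0 < rho) (hA : bounded_op ip A).
Local Notation N := (hnorm ip).

Lemma tau_minus_lin a (f g : int -> H) :
  tau_minus A (fun k => a *: f k + g k) = (fun k => a *: tau_minus A f k + tau_minus A g k).
Proof.
apply/funext => k; rewrite /tau_minus (proj1 hA) opprD addrACA.
by rewrite scalerBr.
Qed.

Lemma spt_geP (a : int) (f : int -> H) :
  spt f `<=` [set k | a <= k] <-> forall k, k < a -> f k = 0.
Proof.
split=> [h k ka|h k /= fk]; last first.
  by rewrite leNgt; apply: contra_neqN fk => /h.
by apply/eqP; apply: contraTT ka => fk; rewrite -leNgt; apply: h.
Qed.

Lemma causal_inverse : pow2_small ip A rho ->
  exists B, is_l2_inverse ip rho A B /\ causal ip rho B.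
Proof.
move=> [m]; rewrite -(prednK (expn_gt0 2 m)) => hm.
have [s [C [L [s0 srho hL]]]] := exists_adapted_norm hH rho0 hA hm.
have [K K0 hK] := solution_l2norm rho0 s0 srho hL.
have /choice[B hB] f : exists y, in_l2 ip rho f -> [/\ tau_minus A y = f, in_l2 ip rho y,
    l2norm ip rho y <= K * l2norm ip rho f
    & forall a : int, (forall k, k < a -> f k = 0) -> forall k, k <= a -> y k = 0].
  (* Outside l_2 nothing is asked of B; f itself is the default value. *)
  have [lf|nlf] := pselect (in_l2 ip rho f); last by exists f.
  have [y [hy yb yc]] := tau_minus_solution hH rho0 hA s0 srho hL lf.
  by exists y => _; have [ly yK] := hK f y lf hy yb; split.
(* B is a mere choice of solutions: its linearity and the left inverse property come from
   uniqueness. *)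
have uniq y y' : in_l2 ip rho y -> in_l2 ip rho y' -> tau_minus A y = tau_minus A y' -> y = y'.
  move=> ly ly' yy'.
  have : (fun k => (-1) *: y' k + y k) = (fun=> 0).
    apply: (tau_minus_inj hH rho0 s0 srho hL); first exact: in_l2_lin.
    by rewrite tau_minus_lin yy'; apply/funext => k; rewrite scaleN1r addNr.
  move=> h; apply/funext => k; have := congr1 (@^~ k) h.
  by rewrite scaleN1r addrC => /subr0_eq.
exists B; split; last first.
  move=> a f lf /spt_geP fa; apply/spt_geP => k ka.
  by have [_ _ _ h] := hB f lf; apply: (h a) => //; exact: ltW.
split; last by move=> f /hB[].
  split=> [f /hB[]//|a f g lf lg|]; last by exists K => f /hB[].
  have [tf lBf _ _] := hB f lf; have [tg lBg _ _] := hB g lg.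
  have [tfg lBfg _ _] := hB _ (in_l2_lin hH rho0 a lf lg).
  by apply: uniq => //; [exact: in_l2_lin | rewrite tau_minus_lin tf tg tfg].
move=> f lf; have ltf := in_l2_tau_minus hH rho0 hA lf.
by have [tf lBf _ _] := hB _ ltf; apply: uniq.
Qed.

Lemma l2w_sum_delta x : l2w_sum ip rho (delta_m1 x) = ((N x * rho) ^+ 2)%:E.
Proof.
pose a (_ : int) : \bar R := ((N x * rho) ^+ 2)%:E.
rewrite (l2w_sumE _ rho0) -[RHS](@esum_set1 _ _ (-1 : int) a); last by rewrite lee_fin sqr_ge0.
rewrite [RHS]esum_mkcond; apply: eq_esum => k _; rewrite /l2_term /delta_m1 /a.
have [->|k1] := eqVneq k (-1); first by rewrite mem_set// opprK expr1z.
by rewrite memNset ?(hnorm0 hH) ?mul0r ?expr0n//= => /eqP; apply/negP.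
Qed.

Lemma in_l2_delta x : in_l2 ip rho (delta_m1 x).
Proof. by rewrite /in_l2 l2w_sum_delta ltry. Qed.

Lemma l2norm_delta x : l2norm ip rho (delta_m1 x) = N x * rho.
Proof.
by rewrite /l2norm l2w_sum_delta /= sqrtr_sqr ger0_norm// mulr_ge0 ?hnorm_ge0 ?ltW.
Qed.

(** Causality alone gives support in k >= -1; the equation at index -2 then yields y_(-1) = A y_(-2)
    = 0. *)
Lemma causal_delta B : is_l2_inverse ip rho A B -> causal ip rho B ->
  forall x, spt (B (delta_m1 x)) `<=` [set k | 0 <= k].
Proof.
move=> [_ _ tB] cB x; set y := B _.
have ty : tau_minus A y = delta_m1 x by apply: tB; exact: in_l2_delta.
have y_lt k : k < -1 -> y k = 0.
  move: k; apply/spt_geP/cB; first exact: in_l2_delta.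
  by apply/spt_geP => k k1; rewrite /delta_m1 lt_eqF.
apply/spt_geP => k k0; have [k1|k1] := ltP k (-1); first exact: y_lt.
have -> : k = -2 + 1 by lia.
have := congr1 (@^~ (-2)) ty; rewrite /tau_minus /delta_m1 /= => /subr0_eq ->.
by rewrite y_lt// (linear0_map (proj1 hA)).
Qed.

Lemma orbit_of_delta B : is_l2_inverse ip rho A B ->
  (forall x, spt (B (delta_m1 x)) `<=` [set k | 0 <= k]) ->
  forall x n, B (delta_m1 x) n%:Z = iter n A x.
Proof.
move=> [_ _ tB] sB x; have /spt_geP := sB x; set y := B _ => y0.
have ty k : y (k + 1) = A (y k) + delta_m1 x k.
  by rewrite -(tB _ (in_l2_delta x)) /tau_minus addrCA subrr addr0.
elim=> [|n IH].
  (* At index -1 the equation reads y_0 = A y_(-1) + x with y_(-1) = 0; at later indices the source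
     vanishes. *)
  by have := ty (-1); rewrite (y0 (-1))// (linear0_map (proj1 hA)) add0r /delta_m1 eqxx.
by rewrite iterS -IH -addn1 PoszD ty /delta_m1 addr0.
Qed.

(* Datko: a square-summable orbit bound forces [n |rho^-n A^n x|^2 <= c^4 |x|^2]. *)
Lemma orbit_square_summable (c : R) : 0 <= c ->
  (forall x n, \sum_(i < n) (N (iter i A x) * rho ^- i) ^+ 2 <= (c * N x) ^+ 2) ->
  exists n, forall x, N (iter n.+1 A x) <= 2^-1 * rho ^+ n.+1 * N x.
Proof.
move=> c0 hc.
have rn n : 0 < rho ^+ n by rewrite exprn_gt0.
have t0 n x : 0 <= N (iter n A x) * rho ^- n.
  by rewrite mulr_ge0 ?hnorm_ge0// invr_ge0 ltW.
have hb n x : N (iter n A x) * rho ^- n <= c * N x.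
  have := hc x n.+1; rewrite big_ord_recr /= => h.
  have : (N (iter n A x) * rho ^- n) ^+ 2 <= (c * N x) ^+ 2.
    by apply: le_trans h; rewrite lerDr; apply: sumr_ge0 => i _; rewrite sqr_ge0.
  by rewrite ler_pXn2r ?nnegrE ?t0// mulr_ge0 ?hnorm_ge0.
(* This m ensures c^4 <= (m + 1) / 4. *)
have [m hm] := archi_ge (4 * c ^+ 4).
exists m => x; set v := N (iter m.+1 A x) * rho ^- m.+1.
have v0 : 0 <= v := t0 _ _.
have h1 : v ^+ 2 *+ m.+1 <= c ^+ 4 * N x ^+ 2.
  apply: (@le_trans _ _ (\sum_(i < m.+1) c ^+ 2 * (N (iter i A x) * rho ^- i) ^+ 2)).
    rewrite -[m.+1 in X in X <= _]card_ord -sumr_const; apply: ler_sum => i _.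
    rewrite -exprMn lerXn2r ?nnegrE ?v0 ?(mulr_ge0 c0)//.
    (* A^(m+1) x factors through A^i x, so v <= c |A^i x| rho^-i for each of the m + 1 indices i. *)
    have -> : v = N (iter (m.+1 - i) A (iter i A x)) * rho ^- (m.+1 - i) * rho ^- i.
      by rewrite -iterD -mulrA -invfM -exprD subnK// ltnW.
    by rewrite mulrA ler_pM2r ?invr_gt0.
  rewrite -mulr_sumr (le_trans (ler_wpM2l (sqr_ge0 c) (hc _ _)))//.
  by rewrite exprMn mulrA -exprD.
have h2 : v ^+ 2 <= (2^-1 * N x) ^+ 2.
  have m0 : 0 < m.+1%:R :> R by rewrite ltr0n.
  rewrite -(ler_pM2r m0) mulr_natr (le_trans h1)// exprMn [leRHS]mulrAC ler_wpM2r ?sqr_ge0//.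
  by rewrite -natr1; move: hm; rewrite [2^-1 ^+ 2]expr2; lra.
move: h2; rewrite ler_pXn2r ?nnegrE ?v0 ?mulr_ge0 ?hnorm_ge0//.
by rewrite /v ler_pdivrMr// mulrAC.
Qed.

Lemma spectral_radius_of_delta B : is_l2_inverse ip rho A B ->
  (forall x, spt (B (delta_m1 x)) `<=` [set k | 0 <= k]) ->
  (spectral_radius ip A < rho%:E)%E.
Proof.
move=> hB sB; have orb := orbit_of_delta hB sB.
case: hB => [[lB _ [M hM]] _ _].
(* The norm of delta_(-1) x is rho |x|, whence the factor rho; the absolute value covers a negative
   M. *)
have c0 : 0 <= `|M| * rho by rewrite mulr_ge0// ltW.
have [|n hn] := @orbit_square_summable (`|M| * rho) c0; last first.
  exact: (spectral_radius_lt hH rho0 hA hn).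
move=> x n; have ld := in_l2_delta x.
have -> : \sum_(i < n) (N (iter i A x) * rho ^- i) ^+ 2 =
    \sum_(i < n) l2_term ip rho (B (delta_m1 x)) (0 + i%:Z).
  by apply: eq_bigr => i _; rewrite add0r /l2_term orb -invr_expz.
rewrite (le_trans (l2_term_sum_le rho0 0 n (lB _ ld)))//.
rewrite lerXn2r ?nnegrE ?l2norm_ge0 ?mulr_ge0 ?hnorm_ge0 ?(ltW rho0)//.
rewrite (le_trans (hM _ ld))// l2norm_delta mulrAC mulrA.
by rewrite ler_pM2r// ler_wpM2r ?hnorm_ge0// ler_norm.
Qed.

End Equivalence.

Theorem theorem3p7 (R : realType) (H : lmodType R[i]) (ip : H -> H -> R[i])
  (hH : is_separable_Hilbert ip) (rho : R) (A : H -> H)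
  (hrho : 0 < rho) (hA : bounded_op ip A) :
  [/\ ((exists B, is_l2_inverse ip rho A B /\ causal ip rho B) <->
       (exists B, is_l2_inverse ip rho A B /\
          forall x : H, spt (B (delta_m1 x)) `<=` [set k | 0 <= k])),
      ((exists B, is_l2_inverse ip rho A B /\
          forall x : H, spt (B (delta_m1 x)) `<=` [set k | 0 <= k]) <->
       (spectral_radius ip A < rho%:E)%E)
    & ((spectral_radius ip A < rho%:E)%E <->
       (exists B, is_l2_inverse ip rho A B /\ causal ip rho B))].
Proof.
have i_ii : (exists B, is_l2_inverse ip rho A B /\ causal ip rho B) ->
    exists B, is_l2_inverse ip rho A B /\
      forall x : H, spt (B (delta_m1 x)) `<=` [set k | 0 <= k].
  by move=> [B [hB cB]]; exists B; split => //; exact: causal_delta hB cB.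
have ii_iii : (exists B, is_l2_inverse ip rho A B /\
      forall x : H, spt (B (delta_m1 x)) `<=` [set k | 0 <= k]) ->
    (spectral_radius ip A < rho%:E)%E.
  by move=> [B [hB sB]]; exact: spectral_radius_of_delta hB sB.
have iii_i : (spectral_radius ip A < rho%:E)%E ->
    exists B, is_l2_inverse ip rho A B /\ causal ip rho B.
  by move=> hr; apply: causal_inverse => //; exact: pow2_small_of_spectral_radius.
by split; split=> // h; auto.
Qed.
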